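(* Reachability and Termination are undecidable for priority channel systems under the strict-superseding semantics, and they are also undecidable for priority channel systems under the overtaking semantics. Here, for a given semantics with step relation $\to$: (Reachability) given a priority channel system $S$, an initial configuration $C_0$ and a recursive set $G$ of configurations of $S$, decide whether $C_0\to^*D$ for some $D\in G$; (Termination) given a priority channel system $S$ and a configuration $C_0$, decide whether every run of $\to$ from $C_0$ is finite.
   Context: For $d\in\mathbb{N}$ let $\Sigma_d=\{0,1,\ldots,d\}$. A level-$d$ priority channel system ($d$-PCS) is a tuple $S=(\Sigma_d,\mathrm{Ch},Q,\Delta)$ where $\mathrm{Ch}=\{c_1,\ldots,c_m\}$ is a finite set of channels, $Q$ is a finite set of control states, and $\Delta\subseteq Q\times \mathrm{Ch}\times\{!,?\}\times\Sigma_d\times Q$ is a set of rules, written $(q,c_i!a,q')$ (write) or $(q,c_i?a,q')$ (read). A priority channel system is a $d$-PCS for some $d$. Configurations: $Q\times(\Sigma_d^* )^m$. Reliable steps: a rule $(q,c_i?a,q')$ gives $(q,x_1,\ldots,x_m)\to(q',y_1,\ldots,y_m)$ if $x_i=a\,y_i$ and $x_j=y_j$ for $j\neq i$; a rule $(q,c_i!a,q')$ gives such a step if $y_i=x_i\,a$ and $x_j=y_j$ for $j\ne i$. In both semantics below, the steps are the reliable steps together with the steps that leave the control state and all channels but one unchanged and rewrite the content $x=a_1\cdots a_\ell$ of the remaining channel, at some position $1\le k<\ell$ with $a_k<a_{k+1}$, as follows. Strict-superseding semantics: $x$ becomes $a_1\cdots a_{k-1}\,a_{k+1}\cdots a_\ell$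 (the letter $a_k$ is erased). Overtaking semantics: $x$ becomes $a_1\cdots a_{k-1}\,a_{k+1}\,a_k\,a_{k+2}\cdots a_\ell$ (the letters $a_k$ and $a_{k+1}$ are swapped). A run is a finite or infinite sequence of consecutive steps. *)

(* Defs.v *)
From Stdlib Require Import Relation_Operators.
From mathcomp Require Import all_boot.

Set Implicit Arguments.
Unset Strict Implicit.
Unset Printing Implicit Defensive.

(** * Partial recursive functions *)

Inductive murec : nat -> Type :=
| Zero : murec 0
| Succ : murec 1
| Proj k (i : 'I_k) : murec k
| Comp k m (f : murec m) (g : 'I_m -> murec k) : murec k
| Prec k (f : murec k) (g : murec k.+2) : murec k.+1
| Mu k (f : murec k.+1) : murec k.

Fixpoint prec_graph (base : nat -> Prop) (next : nat -> nat -> nat -> Prop)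
    (n y : nat) : Prop :=
  match n with
  | 0 => base y
  | p.+1 => exists z, prec_graph base next p z /\ next p z y
  end.

(** [computes f v y]: [f] is defined at [v], with value [y].  For [Prec] the
    recursion argument is the head of [v], and the step function receives the
    predecessor, the previous value and the parameters, in this order. *)
Fixpoint computes k (f : murec k) : k.-tuple nat -> nat -> Prop :=
  match f in murec k return k.-tuple nat -> nat -> Prop with
  | Zero => fun _ y => y = 0
  | Succ => fun v y => y = (thead v).+1
  | Proj _ i => fun v y => y = tnth v i
  | Comp _ m f g => fun v y =>
      exists w : m.-tuple nat,
        (forall i, computes (g i) v (tnth w i)) /\ computes f w y
  | Prec _ f g => fun v y =>
      prec_graph (computes f (behead_tuple v))
        (fun p z => computes g (cons_tuple p (cons_tuple z (behead_tuple v))))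
        (thead v) y
  | Mu _ f => fun v y =>
      computes f (cons_tuple y v) 0 /\
      (forall z, z < y -> exists u, computes f (cons_tuple z v) u.+1)
  end.

(** Gödel numbers.  Here and below, [CodeSeq.code] is the (effective) bijection
    from [seq nat] to [nat].  Arities are not recorded: once the arity of the
    whole function is known, they can be recovered from the code. *)
Fixpoint enc_murec k (f : murec k) : nat :=
  match f with
  | Zero => CodeSeq.code [:: 0]
  | Succ => CodeSeq.code [:: 1]
  | Proj _ i => CodeSeq.code [:: 2; val i]
  | Comp _ m f g =>
      CodeSeq.code [:: 3; enc_murec f;
                       CodeSeq.code [seq enc_murec (g i) | i <- enum 'I_m]]
  | Prec _ f g => CodeSeq.code [:: 4; enc_murec f; enc_murec g]
  | Mu _ f => CodeSeq.code [:: 5; enc_murec f]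
  end.

(** [f] decides the problem [P] whose instances [i : I] are presented to
    algorithms as the natural numbers [enc i].  Nothing is required of [f] on
    numbers that do not encode an instance. *)
Definition decides (I : Type) (enc : I -> nat) (P : I -> Prop) (f : murec 1) :
    Prop :=
  forall i, (P i -> computes f [tuple enc i] 1) /\
            (~ P i -> computes f [tuple enc i] 0).

Definition recursively_decidable (I : Type) (enc : I -> nat) (P : I -> Prop) :
    Prop :=
  exists f : murec 1, decides enc P f.

(** * Priority channel systems *)

(** A rule [(q, c, w, a, q')] is the write rule [(q, c!a, q')] if [w] is [true]
    and the read rule [(q, c?a, q')] if [w] is [false]. *)
Record pcs := Pcs {
  level : nat;
  chan : finType;
  state : finType;
  rules : {set state * chan * bool * 'I_level.+1 * state}
}.

Definition config (S : pcs) : Type :=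
  (state S * {ffun chan S -> seq 'I_(level S).+1})%type.

Inductive reliable_step (S : pcs) : config S -> config S -> Prop :=
| StepRead q c a q' (x y : {ffun chan S -> seq 'I_(level S).+1}) :
    (q, c, false, a, q') \in rules S ->
    x c = a :: y c -> (forall j, j != c -> x j = y j) ->
    reliable_step (q, x) (q', y)
| StepWrite q c a q' (x y : {ffun chan S -> seq 'I_(level S).+1}) :
    (q, c, true, a, q') \in rules S ->
    y c = rcons (x c) a -> (forall j, j != c -> x j = y j) ->
    reliable_step (q, x) (q', y).

(** A semantics is given by how the content of a channel may be rewritten. *)
Definition semantics := forall d : nat, seq 'I_d.+1 -> seq 'I_d.+1 -> Prop.

Inductive strict_superseding (d : nat) : seq 'I_d.+1 -> seq 'I_d.+1 -> Prop :=
| Supersede (u v : seq 'I_d.+1) (a b : 'I_d.+1) : a < b ->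
    strict_superseding (u ++ a :: b :: v) (u ++ b :: v).

Inductive overtaking (d : nat) : seq 'I_d.+1 -> seq 'I_d.+1 -> Prop :=
| Overtake (u v : seq 'I_d.+1) (a b : 'I_d.+1) : a < b ->
    overtaking (u ++ a :: b :: v) (u ++ b :: a :: v).

Inductive step (sem : semantics) (S : pcs) : config S -> config S -> Prop :=
| StepReliable C D : reliable_step C D -> step sem C D
| StepInternal q c (x y : {ffun chan S -> seq 'I_(level S).+1}) :
    sem (level S) (x c) (y c) -> (forall j, j != c -> x j = y j) ->
    step sem (q, x) (q, y).

(** * The decision problems *)

(** The states and the channels of a system are numbered by [enum_rank], so
    that the code of [S] describes [S] up to renaming. *)
Definition enc_rule (S : pcs)
    (r : state S * chan S * bool * 'I_(level S).+1 * state S) : nat :=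
  let: (q, c, w, a, q') := r in
  CodeSeq.code [:: val (enum_rank q); val (enum_rank c); nat_of_bool w; val a;
                   val (enum_rank q')].

Definition enc_pcs (S : pcs) : nat :=
  CodeSeq.code [:: level S; #|chan S|; #|state S|;
                   CodeSeq.code [seq enc_rule r | r <- enum (rules S)]].

Definition enc_config (S : pcs) (C : config S) : nat :=
  CodeSeq.code
    [:: val (enum_rank C.1);
        CodeSeq.code [seq CodeSeq.code [seq val a | a <- C.2 c]
                     | c <- enum (chan S)]].

(** The recursive set [goal] is given to algorithms by the Gödel number of a
    function deciding it. *)
Record reach_instance := ReachInstance {
  reach_sys : pcs;
  reach_init : config reach_sys;
  goal : config reach_sys -> Prop;
  goal_fun : murec 1;
  goal_funP : decides (@enc_config reach_sys) goal goal_fun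
}.

Definition enc_reach (i : reach_instance) : nat :=
  CodeSeq.code [:: enc_pcs (reach_sys i); enc_config (reach_init i);
                   enc_murec (goal_fun i)].

Definition reachability (sem : semantics) (i : reach_instance) : Prop :=
  exists D : config (reach_sys i),
    goal D /\ clos_refl_trans _ (@step sem (reach_sys i)) (reach_init i) D.

Record term_instance := TermInstance {
  term_sys : pcs;
  term_init : config term_sys
}.

Definition enc_term (i : term_instance) : nat :=
  CodeSeq.code [:: enc_pcs (term_sys i); enc_config (term_init i)].

(** Every run is finite: no infinite sequence of configurations is a run. *)
Definition termination (sem : semantics) (i : term_instance) : Prop :=
  forall r : nat -> config (term_sys i),
    r 0 = term_init i -> ~ (forall n, step sem (r n) (r n.+1)).

(* Main.v *)
Require Import Defs.
From Stdlib Require Import Relation_Operators.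
From Stdlib Require Import Operators_Properties FunctionalExtensionality.
From Stdlib Require Import IndefiniteDescription.
From mathcomp Require Import all_boot zify.

Set Implicit Arguments.
Unset Strict Implicit.
Unset Printing Implicit Defensive.

(** A counter with value [n] is stored on a channel with two priorities as a
    word containing [n] letters [1] and a marker [0].  Under either semantics an
    internal step moves the marker one place towards the end of the queue, or
    erases it; so the number of [1]s is always exact and there is at most one
    marker.  Reading a [1] is a decrement.  If the marker is at the head, it is
    read and written back at the end; reading it again at once is possible only
    if the counter is [0], which gives a sound zero test.  Losing the marker can
    only block the system, hence a run never departs from the (deterministic)
    run of the counter machine.

    A recursive function [f] that decides one of the problems yields a counter
    machine that, on input [a] and [b], computes [f] on the code of the instance
    consisting of the system with code [a] and of the initial configuration
    that holds the inputs [a] and [b] themselves, and then halts if the answer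
    is [0] and diverges if it is [1].  Applied to the code of its own channel
    system, it contradicts [f].  As [f] is total on codes of instances, only one
    direction of the correctness of compilation is needed: if [f] is defined,
    then the machine computes its value. *)

(** * Counter machines *)

Definition regs := nat -> nat.

Definition upd (rho : regs) (r v : nat) : regs :=
  fun s => if s == r then v else rho s.

Ltac reg_ext :=
  apply: functional_extensionality => ?; rewrite /upd /=;
  repeat (case: eqP => ?; subst); lia.

Lemma upd_upd rho r v w : upd (upd rho r v) r w = upd rho r w.
Proof. by reg_ext. Qed.

Lemma upd_same rho r v : rho r = v -> upd rho r v = rho.
Proof. by move=> <-; reg_ext. Qed.

Lemma upd_at rho r v : upd rho r v r = v.
Proof. by rewrite /upd eqxx. Qed.

Lemma upd_neq rho r v s : s != r -> upd rho r v s = rho s.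
Proof. by rewrite /upd => /negbTE ->. Qed.

Inductive instr :=
| IHalt
| IInc (r j : nat)
| IJzdec (r z nz : nat).

(** The default [IHalt] of [nth] makes every address outside the program a halting one. *)
Definition mnext (prog : seq instr) (a : nat * regs) : option (nat * regs) :=
  match nth IHalt prog a.1 with
  | IHalt => None
  | IInc r j => Some (j, upd a.2 r (a.2 r).+1)
  | IJzdec r z nz =>
      Some (if a.2 r is n.+1 then (nz, upd a.2 r n) else (z, a.2))
  end.

Definition mstep prog (a b : nat * regs) := mnext prog a = Some b.

Lemma mstep_det prog a b c : mstep prog a b -> mstep prog a c -> b = c.
Proof. by rewrite /mstep => -> []. Qed.

(** * Structured counter programs and their assembly *)

Inductive cmd :=
| Inc (r : nat)
| Clear (r : nat)
| Seq (c1 c2 : cmd)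
| Loop (r : nat) (c : cmd).

(** A big-step relation covers terminating executions only, which is what the single needed
    direction of compiler correctness is about. *)
Inductive exec : cmd -> regs -> regs -> Prop :=
| ExecInc r rho : exec (Inc r) rho (upd rho r (rho r).+1)
| ExecClear r rho : exec (Clear r) rho (upd rho r 0)
| ExecSeq c1 c2 rho1 rho2 rho3 :
    exec c1 rho1 rho2 -> exec c2 rho2 rho3 -> exec (Seq c1 c2) rho1 rho3
| ExecLoop0 r c rho : rho r = 0 -> exec (Loop r c) rho rho
| ExecLoopS r c n rho1 rho2 rho3 :
    rho1 r = n.+1 -> exec c (upd rho1 r n) rho2 ->
    exec (Loop r c) rho2 rho3 -> exec (Loop r c) rho1 rho3.

Fixpoint cmd_size (c : cmd) : nat :=
  match c with
  | Inc _ | Clear _ => 1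
  | Seq c1 c2 => cmd_size c1 + cmd_size c2
  | Loop _ c => (cmd_size c).+1
  end.

(** [c] is compiled at address [i], control leaving to address [j]. *)
Fixpoint assemble (c : cmd) (i j : nat) : seq instr :=
  match c with
  | Inc r => [:: IInc r j]
  | Clear r => [:: IJzdec r j i]
  | Seq c1 c2 =>
      assemble c1 i (i + cmd_size c1) ++ assemble c2 (i + cmd_size c1) j
  | Loop r c => IJzdec r j i.+1 :: assemble c i.+1 i
  end.

Lemma size_assemble c i j : size (assemble c i j) = cmd_size c.
Proof.
elim: c i j => //= [c1 IH1 c2 IH2|r c IH] i j; first by rewrite size_cat IH1 IH2.
by rewrite IH.
Qed.

Definition code_at (prog : seq instr) i s :=
  forall k, k < size s -> nth IHalt prog (i + k) = nth IHalt s k.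

Lemma code_at_cons prog i x s :
  code_at prog i (x :: s) -> nth IHalt prog i = x /\ code_at prog i.+1 s.
Proof.
move=> h; split; first by rewrite -[i]addn0 h.
by move=> k hk; rewrite addSnnS h.
Qed.

Lemma code_at_cat prog i s1 s2 :
  code_at prog i (s1 ++ s2) ->
  code_at prog i s1 /\ code_at prog (i + size s1) s2.
Proof.
move=> h; split=> k hk.
  by rewrite h ?nth_cat ?hk // size_cat ltn_addr.
by rewrite -addnA h ?nth_cat ?size_cat ?ltn_add2l // ltnNge leq_addr /= addKn.
Qed.

Lemma assembleP prog c rho rho' : exec c rho rho' ->
  forall i j, code_at prog i (assemble c i j) ->
  clos_refl_trans _ (mstep prog) (i, rho) (j, rho').
Proof.
elim=> {c rho rho'} /=.
- move=> r rho i j /code_at_cons[hi _]; apply: rt_step.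
  by rewrite /mstep /mnext hi.
- move=> r rho i j /code_at_cons[hi _].
  (* [Clear] is one instruction jumping to itself, so it takes an induction on the value of the
     register. *)
  elim: {rho}(rho r) {-2}rho (erefl (rho r)) => [|n IH] rho hr.
    by apply: rt_step; rewrite /mstep /mnext hi /= hr upd_same.
  apply: (rt_trans _ _ _ (i, upd rho r n)).
    by apply: rt_step; rewrite /mstep /mnext hi /= hr.
  by rewrite -(upd_upd rho r n 0); apply: IH; rewrite upd_at.
- move=> c1 c2 rho1 rho2 rho3 _ IH1 _ IH2 i j /code_at_cat[h1 h2].
  apply: rt_trans (IH1 _ _ h1) _.
  by apply: IH2; rewrite size_assemble in h2.
- move=> r c rho hr i j /code_at_cons[hi _].
  by apply: rt_step; rewrite /mstep /mnext hi /= hr.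
- move=> r c n rho1 rho2 rho3 hr _ IH1 _ IH2 i j h.
  have [hi hc] := code_at_cons h.
  (* The body leaves to address [i], where the same loop is entered again. *)
  apply: rt_trans (IH2 _ _ h); apply: rt_trans (IH1 _ _ hc).
  by apply: rt_step; rewrite /mstep /mnext hi /= hr.
Qed.

(** * Compiling partial recursive functions *)

Definition move_reg s d := Loop s (Inc d).

(** Uses [t], initially [0], as scratch space. *)
Definition copy_reg s d t :=
  Seq (move_reg s t) (Loop t (Seq (Inc s) (Inc d))).

Lemma exec_move s d rho : s != d ->
  exec (move_reg s d) rho (upd (upd rho d (rho d + rho s)) s 0).
Proof.
move=> sd; move hs: (rho s) => n; elim: n rho hs => [|n IH] rho hs.
  rewrite addn0 [upd rho d _]upd_same // upd_same //.
  exact: ExecLoop0.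
apply: ExecLoopS hs (ExecInc _ _) _.
have -> : upd (upd rho d (rho d + n.+1)) s 0 =
  let rho1 := upd (upd rho s n) d (upd rho s n d).+1 in
  upd (upd rho1 d (rho1 d + n)) s 0.
  by reg_ext.
by apply: IH; rewrite /upd (negbTE sd) eqxx.
Qed.

Lemma exec_copy s d t rho : uniq [:: s; d; t] -> rho t = 0 ->
  exec (copy_reg s d t) rho (upd rho d (rho d + rho s)).
Proof.
rewrite /= !inE negb_or !andbT => /andP[/andP[sd st] dt] ht.
apply: ExecSeq (exec_move _ st) _; rewrite ht add0n.
(* The target is rewritten as the effect of the second loop on the state left by the first; that
   state is then generalized for the induction. *)
have -> : upd rho d (rho d + rho s) =
  let rho1 := upd (upd rho t (rho s)) s 0 in
  upd (upd (upd rho1 s (rho1 s + rho1 t)) d (rho1 d + rho1 t)) t 0.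
  by reg_ext.
move: (upd _ s 0) => {ht}rho /=.
move ht: (rho t) => n; elim: n rho ht => [|n IH] rho ht.
  rewrite !addn0 [upd rho s _]upd_same // [upd rho d _]upd_same // upd_same //.
  exact: ExecLoop0.
apply: ExecLoopS ht (ExecSeq (ExecInc _ _) (ExecInc _ _)) _.
set rho1 := upd (upd _ s _) d _.
have -> : upd (upd (upd rho s (rho s + n.+1)) d (rho d + n.+1)) t 0 =
  upd (upd (upd rho1 s (rho1 s + n)) d (rho1 d + n)) t 0.
  by rewrite /rho1; reg_ext.
by apply: IH; rewrite /rho1 /upd eqxx eq_sym (negbTE dt) eq_sym (negbTE st).
Qed.

(** The code for [f] reads its arguments in the registers [args], adds its value
    to the register [o], and uses registers from [n] on as scratch space. *)
Fixpoint compile k (f : murec k) (args : seq nat) (o n : nat) : cmd :=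
  match f with
  | Zero => Clear o
  | Succ => Seq (copy_reg (head 0 args) o n) (Inc o)
  | Proj _ i => copy_reg (nth 0 args i) o n
  | Comp _ m f g =>
      foldr (fun i : 'I_m => Seq (compile (g i) args (n + i) (n + m)))
        (Seq (compile f (iota n m) o (n + m))
             (foldr (fun r => Seq (Clear r)) (Clear (n + m)) (iota n m)))
        (enum 'I_m)
  | Prec _ f g =>
      Seq (copy_reg (head 0 args) n n.+1)
     (Seq (compile f (behead args) o (n + 3))
     (Seq (Loop n
            (Seq (compile g [:: n.+1, o & behead args] n.+2 (n + 3))
            (Seq (Clear o)
            (Seq (move_reg n.+2 o)
                 (Inc n.+1)))))
          (Clear n.+1)))
  | Mu _ f =>
      Seq (compile f (o :: args) n n.+1)
          (Loop n (Seq (Clear n)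
                  (Seq (Inc o)
                       (compile f (o :: args) n n.+1))))
  end.

(** Since the final register file is exactly [upd rho o y], all scratch registers are back to [0],
    so pieces of code can share them and be iterated. *)
Definition compile_correct k (f : murec k) := forall v y, computes f v y ->
  forall (args : seq nat) (o n : nat) (rho : regs),
  map rho args = v -> o < n -> o \notin args -> {in args, forall r, r < n} ->
  rho o = 0 -> (forall r, n <= r -> rho r = 0) ->
  exec (compile f args o n) rho (upd rho o y).

Lemma exec_copy_arg (args : seq nat) i o n (rho : regs) (v : seq nat) :
  map rho args = v -> i < size args -> o < n -> o \notin args ->
  {in args, forall r, r < n} -> rho n = 0 ->
  exec (copy_reg (nth 0 args i) o n) rho (upd rho o (rho o + nth 0 v i)).
Proof.
move=> <- hi on oargs nargs hn; have hin := mem_nth 0 hi.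
rewrite (nth_map 0) //; apply: exec_copy => //=.
have := nargs _ hin; have : nth 0 args i != o by apply: contraNneq oargs => <-.
by move: (nth 0 args i : nat) => x; rewrite !inE; lia.
Qed.

Lemma compile_succ : compile_correct Succ.
Proof.
move=> v y /= -> args o n rho hv on oargs nargs ho hn.
have sz : size args = 1 by rewrite -(size_map rho) hv size_tuple.
have -> : upd rho o (thead v).+1 =
          upd (upd rho o (rho o + nth 0 v 0)) o
              (upd rho o (rho o + nth 0 v 0) o).+1.
  by rewrite upd_upd upd_at ho /thead (tnth_nth 0).
apply: ExecSeq; last exact: ExecInc.
by rewrite -nth0; apply: exec_copy_arg; rewrite ?sz ?hn.
Qed.

Lemma compile_proj k (i : 'I_k) : compile_correct (Proj i).
Proof.
move=> v y /= -> args o n rho hv on oargs nargs ho hn.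
have sz : size args = k by rewrite -(size_map rho) hv size_tuple.
have := exec_copy_arg hv (i := i) _ on oargs nargs (hn n (leqnn _)).
by rewrite ho add0n sz (tnth_nth 0); apply.
Qed.

(** Describes the registers while a composition is evaluated: after [j] inner functions, the state
    is [load n (take j w) rho]. *)
Definition load n (w : seq nat) (rho : regs) : regs :=
  fun r => if n <= r < n + size w then nth 0 w (r - n) else rho r.

Lemma load_out n w rho r : (r < n) || (n + size w <= r) -> load n w rho r = rho r.
Proof. by rewrite /load; case: ifP => //; lia. Qed.

Lemma exec_clears n j rho :
  exec (foldr (fun r => Seq (Clear r)) (Clear (n + j)) (iota n j)) rho
    (fun r => if n <= r <= n + j then 0 else rho r).
Proof.
elim: j n rho => [|j IH] n rho /=.
  rewrite addn0.
  have -> : (fun r => if n <= r <= n then 0 else rho r) = upd rho n 0.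
    by apply: functional_extensionality => r; rewrite /upd eqn_leq andbC.
  exact: ExecClear.
apply: ExecSeq (ExecClear _ _) _; have := IH n.+1 (upd rho n 0).
rewrite addSnnS; congr exec; apply: functional_extensionality => r.
by rewrite /upd; case: eqP; do 2 case: ifP; lia.
Qed.

Lemma compile_comp k m (f : murec m) (g : 'I_m -> murec k) :
  compile_correct f -> (forall i, compile_correct (g i)) ->
  compile_correct (Comp f g).
Proof.
move=> IHf IHg v y /= [w [hg hf]] args o n rho hv on oargs nargs ho hn.
have args_load j : map (load n (take j w) rho) args = v.
  rewrite -hv; apply/eq_in_map => r /nargs lt_rn.
  by rewrite /load leqNgt lt_rn.
have exec_end : exec (Seq (compile f (iota n m) o (n + m))
             (foldr (fun r => Seq (Clear r)) (Clear (n + m)) (iota n m)))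
      (load n w rho) (upd rho o y).
  apply: (@ExecSeq _ _ _ (upd (load n w rho) o y)).
    apply: (IHf _ _ hf).
    - apply: (@eq_from_nth _ 0) => [|i]; rewrite size_map size_iota ?size_tuple //.
      move=> hi; rewrite (nth_map 0) ?size_iota // nth_iota // /load size_tuple.
      by rewrite leq_addr ltn_add2l hi addKn.
    - by rewrite ltn_addr.
    - by rewrite mem_iota; lia.
    - by move=> r; rewrite mem_iota => /andP[].
    - by rewrite /load leqNgt on.
    - move=> r hr; rewrite load_out ?size_tuple ?hn //; first lia.
      by rewrite hr orbT.
  have := exec_clears n m (upd (load n w rho) o y); congr exec.
  apply: functional_extensionality => r; rewrite /upd /load size_tuple.
  case: ifP => hr; first by case: eqP => hro; [|rewrite hn]; lia.
  by case: eqP => // _; rewrite ifF //; lia.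
(* Generalized to the inner functions [s] still to be run, the first [j] values being already
   stored. *)
suff exec_args s j : map val s = iota j (size s) -> j + size s = m ->
    exec (foldr (fun i : 'I_m => Seq (compile (g i) args (n + i) (n + m)))
        (Seq (compile f (iota n m) o (n + m))
             (foldr (fun r => Seq (Clear r)) (Clear (n + m)) (iota n m))) s)
      (load n (take j w) rho) (upd rho o y).
  have := exec_args (enum 'I_m) 0; rewrite val_enum_ord -cardE card_ord.
  have -> : load n (take 0 w) rho = rho; last exact.
  apply: functional_extensionality => r; rewrite /load take0 /=.
  by case: ifP; lia.
elim: s j => [|i s IH] j /=.
  by rewrite addn0 => _ ->; rewrite take_oversize ?size_tuple.
rewrite -addSnnS => -[ij hs] jm; apply: ExecSeq (IH _ hs jm).
have -> : load n (take j.+1 w) rho =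
          upd (load n (take j w) rho) (n + i) (tnth w i).
  apply: functional_extensionality => r; rewrite /upd /load.
  rewrite !size_takel ?size_tuple; try lia; case: eqP => hr.
    rewrite ifT; last lia.
    by rewrite nth_take ?(tnth_nth 0); [congr nth|]; lia.
  do 2 (case: ifP => ?); try lia; rewrite ?nth_take //; lia.
apply: (IHg _ _ _ (hg i)) => //.
- by rewrite ltn_add2l.
- by apply/negP => /nargs; lia.
- by move=> r /nargs; lia.
- by rewrite load_out ?hn ?size_takel ?size_tuple //; lia.
- by move=> r hr; rewrite load_out ?hn ?size_takel ?size_tuple //; lia.
Qed.

Lemma compile_prec k (f : murec k) (g : murec k.+2) :
  compile_correct f -> compile_correct g -> compile_correct (Prec f g).
Proof.
move=> IHf IHg v y /= hy args o n rho hv on oargs nargs ho hn.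
case: args hv oargs nargs => [|a args] hv oargs nargs.
  by have := size_tuple v; rewrite -hv.
have hv' : map rho args = behead_tuple v by rewrite /= -hv.
have ha : rho a = thead v by rewrite /thead (tnth_nth 0) -hv.
have [an oa] : a < n /\ o != a.
  by split; [apply: nargs; rewrite inE eqxx | case/norP: oargs].
have {}oargs : o \notin args by case/norP: oargs.
have {}nargs : {in args, forall r, r < n}.
  by move=> r hr; apply: nargs; rewrite inE hr orbT.
move: hy; rewrite -ha => hy.
have [hn0 hn1 hn2] : [/\ rho n = 0, rho n.+1 = 0 & rho n.+2 = 0].
  by split; apply: hn; lia.
(* Register [n] holds the number [c] of iterations left, [n.+1] the recursion argument [p] reached,
   and [o] the value [z] at [p]. *)
pose st c p z := upd (upd (upd rho n c) n.+1 p) o z.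
have args_st c p z : map (st c p z) args = behead_tuple v.
  rewrite -hv'; apply/eq_in_map => r hr; have := nargs _ hr.
  have : r != o by apply: contraNneq oargs => <-.
  by rewrite /st /upd; do ?case: eqP; lia.
apply: (@ExecSeq _ _ _ (st (rho a) 0 0)).
  have -> : st (rho a) 0 0 = upd rho n (rho n + rho a).
    by rewrite /st; reg_ext.
  by apply: exec_copy; rewrite ?hn //= !inE; lia.
set body := Seq (compile g _ _ _) _.
(* [prec_graph] exposes the last iteration and [ExecLoopS] the first. Hence the continuation form:
   an execution of the loop from stage [p] extends backwards to one from stage [0], whose value [z0]
   is found on the way. *)
have run p z : prec_graph (computes f (behead_tuple v))
    (fun p z => computes g (cons_tuple p (cons_tuple z (behead_tuple v)))) p z ->
  exists2 z0, computes f (behead_tuple v) z0 &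
    forall c rho', exec (Loop n body) (st c p z) rho' ->
      exec (Loop n body) (st (c + p) 0 z0) rho'.
  elim: p z => [|p IH] z /=; first by exists z => // c rho'; rewrite addn0.
  move=> [z' [/IH[z0 hz0 loop] hz]]; exists z0 => // c rho' hexec.
  rewrite -addSnnS; apply: loop; apply: (@ExecLoopS _ _ c) hexec.
    by rewrite /st /upd; do ?case: eqP; lia.
  have -> : upd (st c.+1 p z') n c = st c p z' by rewrite /st; reg_ext.
  apply: (@ExecSeq _ _ _ (upd (st c p z') n.+2 z)).
    apply: (IHg _ _ hz).
    - rewrite /= args_st /st /upd; congr [:: _, _ & _]; do ?case: eqP; lia.
    - lia.
    - rewrite !inE; apply/negP => /or3P[||/nargs]; lia.
    - by move=> r; rewrite !inE => /or3P[||/nargs]; lia.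
    - by rewrite /st /upd; do ?case: eqP; lia.
    - by move=> r hr; have := hn r; rewrite /st /upd; do ?case: eqP; lia.
  apply: ExecSeq (ExecClear _ _) _.
  apply: ExecSeq (exec_move _ _) _; first lia.
  set rho1 := upd (upd _ _ _) _ _.
  have -> : st c p.+1 z = upd rho1 n.+1 (rho1 n.+1).+1.
    by rewrite /rho1 /st; reg_ext.
  exact: ExecInc.
have [z0 hz0 loop] := run _ _ hy.
apply: (@ExecSeq _ _ _ (st (rho a) 0 z0)).
  have -> : st (rho a) 0 z0 = upd (st (rho a) 0 0) o z0 by rewrite /st upd_upd.
  apply: (IHf _ _ hz0) => //; first lia.
  - by move=> r /nargs; lia.
  - exact: upd_at.
  - by move=> r hr; have := hn r; rewrite /st /upd; do ?case: eqP; lia.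
apply: (@ExecSeq _ _ _ (st 0 (rho a) y)); last first.
  have -> : upd rho o y = upd (st 0 (rho a) y) n.+1 0.
    by rewrite /st; reg_ext.
  exact: ExecClear.
rewrite -[rho a]add0n; apply: loop; rewrite add0n; apply: ExecLoop0.
by rewrite /st /upd; do ?case: eqP; lia.
Qed.

Lemma compile_mu k (f : murec k.+1) :
  compile_correct f -> compile_correct (Mu f).
Proof.
move=> IH v y /= [hy0 hy] args o n rho hv on oargs nargs ho hn.
have run z x : computes f (cons_tuple z v) x ->
    exec (compile f (o :: args) n n.+1) (upd rho o z) (upd (upd rho o z) n x).
  move=> hx; apply: (IH _ _ hx).
  - rewrite /= upd_at -hv; congr cons; apply/eq_in_map => r hr.
    by rewrite upd_neq //; apply: contraNneq oargs => <-.
  - lia.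
  - by rewrite inE; apply/negP => /orP[|/nargs]; lia.
  - by move=> r; rewrite inE => /orP[|/nargs]; lia.
  - by rewrite /upd hn //; case: eqP; lia.
  - by move=> r hr; rewrite /upd hn; [case: eqP|]; lia.
set body := Seq (Clear n) _.
(* Induction on the distance [d] to the least zero. The value [x] at the candidate [z] is part of
   the claim because the loop tests it in register [n]. *)
have loop d z : z + d = y -> exists2 x, computes f (cons_tuple z v) x &
    exec (Loop n body) (upd (upd rho o z) n x) (upd rho o y).
  elim: d z => [|d IHd] z zd.
    exists 0; first by rewrite -zd addn0 in hy0.
    rewrite upd_same -?zd ?addn0; last by rewrite /upd hn //; case: eqP; lia.
    by apply: ExecLoop0; rewrite /upd hn //; case: eqP; lia.
  have [|x hx] := hy z; first lia.
  have [|x' hx' hexec] := IHd z.+1; first lia.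
  exists x.+1 => //; apply: ExecLoopS (upd_at _ _ _) _ hexec.
  apply: ExecSeq (ExecClear _ _) _; rewrite !upd_upd.
  rewrite [upd _ n 0]upd_same; last by rewrite /upd hn //; case: eqP; lia.
  apply: ExecSeq (ExecInc _ _) _; rewrite upd_at upd_upd; exact: run.
have [|x hx hexec] := loop y 0; first by [].
apply: ExecSeq hexec; have := run _ _ hx; by rewrite [upd rho o 0]upd_same.
Qed.

Lemma compileP k (f : murec k) : compile_correct f.
Proof.
elim: f => {k}.
- move=> v y /= -> args o n rho _ _ _ _ ho _; exact: ExecClear.
- exact: compile_succ.
- exact: compile_proj.
- move=> k m f IHf g IHg; exact: compile_comp.
- move=> k f IHf g IHg; exact: compile_prec.
- move=> k f IHf; exact: compile_mu.
Qed.

(** * Counters as channel contents *)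

Notation zero := (ord0 : 'I_2).
Notation one := (ord_max : 'I_2).
Notation zeros := (count_mem zero).
Notation ones := (count_mem one).

Lemma ord2P (a : 'I_2) : a = zero \/ a = one.
Proof. by case: a => [[|[|]]] // ?; [left|right]; apply: val_inj. Qed.

Definition counter_word n : seq 'I_2 := rcons (nseq n one) zero.

(** With two letters the only increasing pair is [0], [1], so this relation covers the internal
    steps of both semantics; nothing else about them is used for soundness. *)
Definition lossy (x y : seq 'I_2) := exists u v, x = u ++ zero :: one :: v /\
  (y = u ++ one :: v \/ y = u ++ one :: zero :: v).

Lemma lossy_intro (u v : seq 'I_2) (a b : 'I_2) y : a < b ->
  (y = u ++ b :: v \/ y = u ++ b :: a :: v) -> lossy (u ++ a :: b :: v) y.
Proof.
by case: (ord2P a) => ->; case: (ord2P b) => -> // _ hy; exists u, v.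
Qed.

Lemma strict_superseding_lossy (x y : seq 'I_2) :
  @strict_superseding 1 x y -> lossy x y.
Proof. by case=> u v a b ab; apply: lossy_intro ab _; left. Qed.

Lemma overtaking_lossy (x y : seq 'I_2) : @overtaking 1 x y -> lossy x y.
Proof. by case=> u v a b ab; apply: lossy_intro ab _; right. Qed.

(** The number of pairs of a [0] before a [1], plus the number of [0]s: a measure showing that
    internal steps alone terminate. *)
Fixpoint disorder (x : seq 'I_2) : nat :=
  if x is a :: x' then (if a == zero then (ones x').+1 else 0) + disorder x'
  else 0.

Lemma lossyP x y : lossy x y ->
  [/\ ones y = ones x, zeros y <= zeros x & disorder y < disorder x].
Proof.
case=> u [v [-> hy]].
have [h1 h0 hd] : [/\ ones y = ones u + (ones v).+1,
    zeros y <= zeros u + (zeros v).+1 &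
    disorder y < disorder (u ++ zero :: one :: v)].
  case: hy => ->; rewrite !count_cat /=; split; try lia.
    by elim: u => [|a u IH] /=; last case: (a == zero); rewrite ?count_cat /=; lia.
  by elim: u => [|a u IH] /=; last case: (a == zero); rewrite ?count_cat /=; lia.
by rewrite h1 !count_cat /=; split=> //; lia.
Qed.

Lemma zeros0 x : zeros x = 0 -> x = nseq (ones x) one.
Proof. by elim: x => //= a x IH; case: (ord2P a) => -> //= /IH{1}->. Qed.

Lemma lossy_counter_word n y : ~ lossy (counter_word n) y.
Proof.
case=> u [v [+ _]]; elim: n u => [|n IH] [|a u] //= [_]; first by case: u.
exact: IH.
Qed.

Lemma ones_counter_word n : ones (counter_word n) = n.
Proof. by rewrite /counter_word -cats1 count_cat count_nseq /= mul1n !addn0. Qed.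

Lemma zeros_counter_word n : zeros (counter_word n) = 1.
Proof. by rewrite /counter_word -cats1 count_cat count_nseq /= mul0n. Qed.

(** * The channel system of a counter machine *)

(** In stage [1] of a zero test the marker is off the channel. In stage [2] it is back at the very
    end, so that reading it there proves the counter to be [0]; stage [3] then restores it. *)
Definition rules_of (i : nat) (ins : instr) : seq (nat * nat * bool * nat * nat) :=
  match ins with
  | IHalt => [::]
  | IInc r j => [:: (4 * i, r, true, 1, 4 * j)]
  | IJzdec r z nz =>
      [:: (4 * i, r, false, 1, 4 * nz); (4 * i, r, false, 0, 4 * i + 1);
          (4 * i + 1, r, true, 0, 4 * i + 2);
          (4 * i + 2, r, false, 1, 4 * nz); (4 * i + 2, r, false, 0, 4 * i + 3);
          (4 * i + 3, r, true, 0, 4 * z)]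
  end.

Lemma read_rule i ins q c l q' : (q, c, false, l, q') \in rules_of i ins ->
  exists z nz k, [/\ ins = IJzdec c z nz, k = 0 \/ k = 2, q = 4 * i + k &
    l = 1 /\ q' = 4 * nz \/ l = 0 /\ q' = 4 * i + k.+1].
Proof.
case: ins => [|r j|r z nz] //=; rewrite !inE; first by case/eqP.
case/or4P => [/eqP[-> -> -> ->]|/eqP[-> -> -> ->]|/eqP[]//|/or3P[]].
- by exists z, nz, 0; rewrite addn0; split; auto.
- by exists z, nz, 0; rewrite addn0; split; auto.
- by case/eqP => -> -> -> ->; exists z, nz, 2; split; auto.
- by case/eqP => -> -> -> ->; exists z, nz, 2; split; auto.
- by case/eqP.
Qed.

Lemma write_rule i ins q c l q' : (q, c, true, l, q') \in rules_of i ins ->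
  (exists j, [/\ ins = IInc c j, l = 1, q = 4 * i & q' = 4 * j]) \/
  (exists z nz k, [/\ ins = IJzdec c z nz, l = 0, q = 4 * i + k &
    k = 1 /\ q' = 4 * i + 2 \/ k = 3 /\ q' = 4 * z]).
Proof.
case: ins => [|r j|r z nz] //=; rewrite !inE.
  by move=> /eqP[-> -> -> ->]; left; exists j.
case/or4P => [/eqP[]//|/eqP[]//|/eqP[-> -> -> ->]|/or3P[/eqP[]//|/eqP[]//|]].
  by right; exists z, nz, 1; split; auto.
by case/eqP => -> -> -> ->; right; exists z, nz, 3; split; auto.
Qed.

Definition rule_list (prog : seq instr) :=
  flatten [seq rules_of i (nth IHalt prog i) | i <- iota 0 (size prog)].

Definition instr_bound (ins : instr) : nat :=
  match ins with
  | IHalt => 0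
  | IInc r j => r + j
  | IJzdec r z nz => r + z + nz
  end.

(** A crude bound on all registers and addresses, which makes the finite sets of channels and states
    large enough for [inord] to be faithful. *)
Definition prog_bound (prog : seq instr) : nat :=
  size prog + sumn [seq instr_bound ins | ins <- prog].

Lemma rule_listP prog t : reflect
  (exists2 i, i < size prog & t \in rules_of i (nth IHalt prog i))
  (t \in rule_list prog).
Proof.
apply: (iffP flatten_mapP) => -[i hi ht]; exists i => //.
  by rewrite mem_iota in hi.
by rewrite mem_iota.
Qed.

Lemma instr_bound_nth prog i : i < size prog ->
  instr_bound (nth IHalt prog i) + size prog <= prog_bound prog.
Proof.
rewrite addnC leq_add2l; elim: prog i => //= ins prog IH [|i] /= hi.
  exact: leq_addr.
by apply: leq_trans (IH _ hi) (leq_addl _ _).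
Qed.

Section Simulation.

Variable prog : seq instr.

(** State [4 * i + m] is the [m]-th stage of the execution of instruction
    [i].  The two spare channels guarantee that registers [0] and [1] exist. *)
Definition machine_pcs : pcs :=
  @Pcs 1 'I_(prog_bound prog).+2 'I_(4 * prog_bound prog).+4
    [set t | let: (q, c, w, a, q') := t in
      (val q, val c, w, val a, val q') \in rule_list prog].

(** * Soundness: the channel system follows the machine *)

Notation contents := {ffun chan machine_pcs -> seq 'I_2}.

Implicit Types (a b : nat * regs) (C D : config machine_pcs).

(** The content of the tested channel at each stage. From stage [1] on it has no [0] before a [1],
    so internal steps cannot touch it; this makes the zero test sound. *)
Definition micro_ok (m : nat) (w : seq 'I_2) : Prop :=
  match m with
  | 0 => True
  | 1 => zeros w = 0
  | 2 => exists n, w = counter_word n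
  | 3 => w = [::]
  | _ => False
  end.

(** Only a bound on the markers is kept, because superseding may erase one. *)
Definition counters_ok (rho : regs) (x : contents) :=
  forall c, ones (x c) = rho (val c) /\ zeros (x c) <= 1.

Definition sim a C : Prop := counters_ok a.2 C.2 /\
  exists m, val C.1 = 4 * a.1 + m /\
    (m = 0 \/ exists c z nz,
      nth IHalt prog a.1 = IJzdec (val c) z nz /\ micro_ok m (C.2 c)).

Lemma micro_lt m w : micro_ok m w -> m < 4.
Proof. by case: m => [|[|[|[|]]]]. Qed.

Lemma sim_lt a C : sim a C -> val C.1 < 4 * a.1 + 4.
Proof.
by case=> _ [m [-> [->|[c [z [nz [_ /micro_lt]]]]]]]; lia.
Qed.

Definition config_disorder C := \sum_c disorder (C.2 c).

Lemma counters_upd rho (x y : contents) c :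
  counters_ok rho x -> (forall j, j != c -> x j = y j) -> zeros (y c) <= 1 ->
  counters_ok (upd rho (val c) (ones (y c))) y.
Proof.
move=> hx xy hz j; rewrite /upd; case: (eqVneq j c) => [->|jc].
  by rewrite eqxx.
by rewrite -xy // ifN.
Qed.

Lemma counters_eq rho (x y : contents) c :
  counters_ok rho x -> (forall j, j != c -> x j = y j) -> zeros (y c) <= 1 ->
  ones (y c) = ones (x c) -> counters_ok rho y.
Proof.
move=> hx xy hz ho; have [h _] := hx c.
by have := counters_upd hx xy hz; rewrite ho upd_same.
Qed.

Lemma sim_reliable a C D : sim a C -> reliable_step C D ->
  (sim a D /\ val C.1 < val D.1) \/ (exists2 b, mstep prog a b & sim b D).
Proof.
case: a => i rho [/= hx [m [hq hm]]] hCD.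
have hm4 : m < 4 by case: hm => [->|[c [z [nz [_ /micro_lt]]]]].
(* The state number determines address and stage by division by [4], and the instruction at that
   address determines the tested channel. *)
have stage i' c z nz k : nth IHalt prog i' = IJzdec (val c) z nz ->
    val C.1 = 4 * i' + k -> k < 4 -> i' = i /\ micro_ok k (C.2 c).
  move=> hi' hq' hk; have [? ?] : i' = i /\ m = k.
    by have : 4 * i' + k = 4 * i + m; [rewrite -hq' -hq | lia].
  subst i' k; split=> //; case: hm => [->|] //.
  by move=> [c' [z' [nz' [hi'' +]]]]; move: hi'; rewrite hi'' => -[/val_inj->].
have sim_next b (x : contents) (q : state machine_pcs) :
    counters_ok b.2 x -> val q = 4 * b.1 -> sim b (q, x).
  by move=> h1 h2; split=> //; exists 0; split; [rewrite addn0 | left].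
case: hCD hx hq hm stage => {C D} [q c l q' x y|q c l q' x y]; rewrite inE.
  move=> /rule_listP[i' _ /read_rule[z [nz [k [hi hk qk hl]]]]].
  move=> xc xy hx hq _ stage.
  have [|? hmicro] := stage _ _ _ _ _ hi qk; first by case: hk => ->.
  subst i'; have [h1 h0] := hx c; rewrite /= xc /= in h1 h0 hmicro.
  have hy : zeros (y c) <= 1 by apply: leq_trans (leq_addl _ _) h0.
  case: hl => -[hl hq']; [right | left].
    have {}hl : l = one by apply: val_inj.
    rewrite hl /= add1n in h1.
    exists (nz, upd rho (val c) (ones (y c))).
      by rewrite /mstep /mnext /= hi -h1.
    by apply: (sim_next (nz, _) y q') => //; apply: counters_upd hx xy hy.
  have {}hl : l = zero by apply: val_inj.
  rewrite hl /= ?add0n add1n ltnS leqn0 in h1 h0 hmicro.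
  split; last by rewrite /= qk hq'; lia.
  split; first by apply: counters_eq hx xy hy _; rewrite xc hl.
  exists k.+1; split=> //; right; exists c, z, nz; split=> //.
  (* At stage [0] the only marker has just been removed. At stage [2] the content was a counter word
     headed by its marker, so nothing is left. *)
  case: hk hmicro => -> /=; first by move/eqP: h0.
  by case=> -[|n] // [<-].
move=> /rule_listP[i' _ /write_rule hr] yc xy hx hq hm stage.
have [h1 h0] := hx c; case: hr => [[j [hi hl qi hq']]|].
  have [? ?] : i' = i /\ m = 0.
    by have : 4 * i' = 4 * i + m; [rewrite -qi -hq | lia].
  subst i' m; have {}hl : l = one by apply: val_inj.
  have h1' : ones (y c) = (rho (val c)).+1.
    by rewrite yc hl -cats1 count_cat h1 /= addn0 addn1.
  right; exists (j, upd rho (val c) (ones (y c))).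
    by rewrite /mstep /mnext /= hi h1'.
  apply: (sim_next (j, _) y q') => //; apply: counters_upd hx xy _.
  by rewrite yc hl -cats1 count_cat /= !addn0.
move=> [z [nz [k [hi hl qk hk]]]]; have {}hl : l = zero by apply: val_inj.
have [|? hmicro] := stage _ _ _ _ _ hi qk; first by case: hk => -[-> _].
subst i' l; case: hk qk hmicro => -[-> hq'] qk /=.
  move=> hz; left; have hy : y c = counter_word (ones (x c)).
    by rewrite yc {1}(zeros0 hz).
  split; last by rewrite /= qk hq'; lia.
  split.
    apply: counters_eq hx xy _ _; rewrite hy; first by rewrite zeros_counter_word.
    by rewrite ones_counter_word.
  exists 2; split=> //; right; exists c, z, nz; split=> //.
  by exists (ones (x c)).
move=> xc; right; exists (z, rho).
  by rewrite /mstep /mnext /= hi -h1 /= xc.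
by apply: (sim_next (z, rho) y q') => //; apply: counters_eq hx xy _ _;
  rewrite yc xc.
Qed.

Lemma sim_internal a q c (x y : contents) :
  sim a (q, x) -> lossy (x c) (y c) -> (forall j, j != c -> x j = y j) ->
  sim a (q, y) /\ config_disorder (q, y) < config_disorder (q, x).
Proof.
move=> [/= hx [m [hq hm]]] hxy xy; have [h1 h0 hd] := lossyP hxy.
split; last first.
  rewrite /config_disorder (bigD1 c) //= [X in _ < X](bigD1 c) //=.
  rewrite -addSn leq_add // leq_eqVlt; apply/orP; left.
  by apply/eqP; apply: eq_bigr => j /xy->.
have hz : zeros (y c) <= 1 by apply: leq_trans h0 _; case: (hx c).
split; first exact: counters_eq hx xy hz h1.
exists m; split=> //; case: hm => [|[d [z [nz [hi hmicro]]]]]; [by left | right].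
exists d, z, nz; split=> //=; case: (eqVneq d c) => [dc|/xy<-//].
subst d; case: m hmicro {hq} => [|[|[|[|]]]] //=.
- by move=> hz0; apply/eqP; rewrite hz0 leqn0 in h0.
- by case=> n hn; rewrite hn in hxy; case: (lossy_counter_word hxy).
- by move=> hn; rewrite hn in hxy; case: hxy => -[|? ?] [? []].
Qed.

Variable sem : semantics.
Hypothesis sem_lossy : forall x y : seq 'I_2, @sem 1 x y -> lossy x y.

Lemma sim_step a C D : sim a C -> step sem C D ->
  (sim a D /\ (val C.1 < val D.1 \/
     C.1 = D.1 /\ config_disorder D < config_disorder C)) \/
  (exists2 b, mstep prog a b & sim b D).
Proof.
move=> hs hCD; case: hCD hs => {C D} [C D hCD hs|q c x y hxy xy hs].
  by case: (sim_reliable hs hCD) => [[hD lt]|]; [left; split; [|left] | right].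
by left; have [hD lt] := sim_internal hs (sem_lossy hxy) xy; split=> //; right.
Qed.

(** A lexicographic induction: on the machine computation, then on the distance of the state number
    from the end of its block of four, then on the disorder. By [sim_step] every step decreases one
    of them and keeps the earlier ones. *)
Lemma sim_Acc a : Acc (fun b a => mstep prog a b) a ->
  forall C, sim a C -> Acc (fun D C => step sem C D) C.
Proof.
elim=> {}a _ IH C; move Ek : (4 * a.1 + 4 - val C.1) => k.
elim: k {-2}k (leqnn k) C Ek => [|k IHk] k' hk' C Ek hC.
  by have := sim_lt hC; lia.
move Ed : (config_disorder C) => d; elim/ltn_ind: d C Ek hC Ed => d IHd C Ek hC Ed.
constructor=> D hCD; case: (sim_step hC hCD) => [[hD [lt|[eq lt]]]|[b hab hb]].
- by apply: (IHk _ _ D erefl hD); have := sim_lt hD; lia.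
- by apply: (IHd _ _ D _ hD erefl); [rewrite -Ed | rewrite -eq].
- exact: IH hab _ hb.
Qed.

(** * Completeness: machine steps are realized by the channel system *)

Definition live a C : Prop := val C.1 = 4 * a.1 /\
  forall c, ones (C.2 c) = a.2 (val c) /\ zeros (C.2 c) = 1.

Lemma live_sim a C : live a C -> sim a C.
Proof.
move=> [hq hx]; split; first by move=> c; have [-> ->] := hx c.
by exists 0; split; [rewrite addn0 | left].
Qed.

Definition set_chan (x : contents) c w : contents :=
  [ffun j => if j == c then w else x j].

Lemma set_chan_at x c w : set_chan x c w c = w.
Proof. by rewrite ffunE eqxx. Qed.

Lemma set_chan_neq x c w j : j != c -> set_chan x c w j = x j.
Proof. by rewrite ffunE => /negbTE->. Qed.

Lemma set_chan_twice x c w w' : set_chan (set_chan x c w) c w' = set_chan x c w'.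
Proof. by apply/ffunP => j; rewrite !ffunE; case: eqP. Qed.

Lemma fire_read (q : state machine_pcs) (c : chan machine_pcs) (l : 'I_2)
    (q' : state machine_pcs) (x : contents) w n r n' :
  val q = n -> val c = r -> val q' = n' ->
  (n, r, false, val l, n') \in rule_list prog -> x c = l :: w ->
  step sem (q, x) (q', set_chan x c w).
Proof.
move=> <- <- <- hr xc; apply: StepReliable; apply: (@StepRead machine_pcs q c l q').
- by rewrite inE.
- by rewrite set_chan_at.
- by move=> j jc; rewrite set_chan_neq.
Qed.

Lemma fire_write (q : state machine_pcs) (c : chan machine_pcs) (l : 'I_2)
    (q' : state machine_pcs) (x : contents) n r n' :
  val q = n -> val c = r -> val q' = n' ->
  (n, r, true, val l, n') \in rule_list prog ->
  step sem (q, x) (q', set_chan x c (rcons (x c) l)).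
Proof.
move=> <- <- <- hr; apply: StepReliable; apply: (@StepWrite machine_pcs q c l q').
- by rewrite inE.
- by rewrite set_chan_at.
- by move=> j jc; rewrite set_chan_neq.
Qed.

Lemma live_set_chan (rho : regs) (x : contents) c w (q : state machine_pcs) i :
  (forall c, ones (x c) = rho (val c) /\ zeros (x c) = 1) ->
  zeros w = 1 -> val q = 4 * i ->
  live (i, upd rho (val c) (ones w)) (q, set_chan x c w).
Proof.
move=> hx hw hq; split=> //= j; rewrite /upd; case: (eqVneq j c) => [->|jc].
  by rewrite eqxx set_chan_at.
by rewrite set_chan_neq // ifN.
Qed.

(** Reliable steps suffice, so this holds for any semantics. Exhibiting a first step to [D] records
    that the path is nonempty, as needed to build infinite runs. *)
Lemma live_mstep a b C : live a C -> mstep prog a b ->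
  exists D E, [/\ step sem C D,
    clos_refl_trans_1n _ (@step sem machine_pcs) D E & live b E].
Proof.
case: a C => i rho [q x] [/= hq hx]; rewrite /mstep /mnext /=.
case: (ltnP i (size prog)) => hi; last by rewrite nth_default.
have hb := instr_bound_nth hi; set N := prog_bound prog in hb.
pose st n : state machine_pcs := inord n.
have stE n : n < (4 * N).+4 -> val (st n) = n by apply: inordK.
case E: (nth IHalt prog i) hb => [|r j|r z nz] //= hb [<-].
  pose c : chan machine_pcs := inord r.
  have cr : val c = r by apply: inordK; lia.
  have [h1 h0] := hx c.
  do 2 exists (st (4 * j), set_chan x c (rcons (x c) one)); split.
  - apply: (fire_write _ hq cr (stE _ _)); first lia.
    by apply/rule_listP; exists i; rewrite // E /= inE.
  - exact: rt1n_refl.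
  - have -> : (rho r).+1 = ones (rcons (x c) one).
      by rewrite -cats1 count_cat /= h1 cr addn1.
    rewrite -cr; apply: live_set_chan => //; last by rewrite stE; lia.
    by rewrite -cats1 count_cat /= h0.
pose c : chan machine_pcs := inord r.
have cr : val c = r by apply: inordK; lia.
have rule t : t \in rules_of i (IJzdec r z nz) -> t \in rule_list prog.
  by move=> ht; apply/rule_listP; exists i; rewrite ?E.
have [] := hx c; rewrite cr; case xc: (x c) => [|l w] //=.
have [st1 st2 st3] : [/\ val (st (4 * i + 1)) = 4 * i + 1,
  val (st (4 * i + 2)) = 4 * i + 2 & val (st (4 * i + 3)) = 4 * i + 3].
  by split; apply: stE; lia.
have stz : val (st (4 * z)) = 4 * z by apply: stE; lia.
have stnz : val (st (4 * nz)) = 4 * nz by apply: stE; lia.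
(* A [1] at the head is consumed at once, wherever the marker is. If the marker is at the head, the
   rest is all [1]s and the test is carried through. *)
case: (ord2P l) => ? /=; subst l; last first.
  rewrite add1n add0n => <- h0 /=.
  do 2 exists (st (4 * nz), set_chan x c w).
  split; [|exact: rt1n_refl|by rewrite -cr; apply: live_set_chan].
  apply: (fire_read hq cr (stE _ _) _ xc); first lia.
  by apply: rule; rewrite !inE eqxx.
rewrite add0n add1n => h1 [h0]; have {}h0 := zeros0 h0; rewrite h1 in h0.
exists (st (4 * i + 1), set_chan x c w).
have step1 : step sem (q, x) (st (4 * i + 1), set_chan x c w).
  apply: (fire_read hq cr (stE _ _) _ xc); first lia.
  by apply: rule; rewrite !inE eqxx ?orbT.
have step2 : step sem (st (4 * i + 1), set_chan x c w)
    (st (4 * i + 2), set_chan x c (counter_word (rho r))).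
  have -> : set_chan x c (counter_word (rho r)) = set_chan (set_chan x c w) c
      (rcons (set_chan x c w c) zero) by rewrite set_chan_twice set_chan_at h0.
  apply: (fire_write _ st1 cr st2).
  by apply: rule; rewrite !inE eqxx ?orbT.
case hr: (rho r) => [|n].
  exists (st (4 * z), set_chan x c [:: zero]); split=> //.
    apply: Relation_Operators.rt1n_trans step2 _; rewrite hr.
    apply: (@Relation_Operators.rt1n_trans _ _ _ (st (4 * i + 3), set_chan x c [::])).
      rewrite -(set_chan_twice x c (counter_word 0) [::]).
      apply: (fire_read st2 cr st3 _ (set_chan_at _ _ _)).
      by apply: rule; rewrite !inE eqxx ?orbT.
    apply: Relation_Operators.rt1n_trans (rt1n_refl _ _ _).
    have := @fire_write _ _ zero _ (set_chan x c [::]) _ _ _ st3 cr stz.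
    rewrite set_chan_twice set_chan_at; apply.
    by apply: rule; rewrite !inE eqxx ?orbT.
  by rewrite -(upd_same hr) -cr; apply: (@live_set_chan _ _ _ [:: zero]).
exists (st (4 * nz), set_chan x c (counter_word n)); split=> //.
  apply: Relation_Operators.rt1n_trans step2 _; rewrite hr.
  apply: Relation_Operators.rt1n_trans (rt1n_refl _ _ _).
  rewrite -(set_chan_twice x c (counter_word n.+1) (counter_word n)).
  apply: (fire_read st2 cr stnz _ (set_chan_at _ _ _)).
  by apply: rule; rewrite !inE eqxx ?orbT.
rewrite -cr -{1}(ones_counter_word n); apply: live_set_chan => //.
exact: zeros_counter_word.
Qed.

Lemma mstep_halt rho b : nth IHalt prog 0 = IHalt -> ~ mstep prog (0, rho) b.
Proof. by rewrite /mstep /mnext /= => ->. Qed.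

(** The machine is deterministic, so its halting run is its only one. *)
Lemma halting_Acc a rho : nth IHalt prog 0 = IHalt ->
  clos_refl_trans_1n _ (mstep prog) a (0, rho) ->
  Acc (fun b a => mstep prog a b) a.
Proof.
move=> h0; move Eb : (0, rho) => b hab.
elim: hab Eb => {a b} [a <-|a b c hab _ IH /IH hb]; first by constructor=> b /mstep_halt.
by constructor=> b' /(mstep_det hab) <-.
Qed.

Lemma halting_reach a rho C :
  clos_refl_trans_1n _ (mstep prog) a (0, rho) -> live a C ->
  exists2 D, val D.1 = 0 & clos_refl_trans _ (@step sem machine_pcs) C D.
Proof.
move Eb : (0, rho) => b hab.
elim: hab Eb C => {a b} [a <- C [hC _]|a b c hab _ IH /IH{}IH C hC].
  by exists C; [rewrite hC | apply: rt_refl].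
have [D [E [CD DE /IH[F hF EF]]]] := live_mstep hC hab.
exists F => //; apply: rt_trans (rt_step _ _ _ _ CD) _; apply: rt_trans EF.
exact: clos_rt1n_rt.
Qed.

Section Divergence.

(** Divergence is expressed by a set of machine configurations closed under steps and containing no
    halting one. *)
Variable Q : nat * regs -> Prop.
Hypothesis Q_mstep : forall a b, Q a -> mstep prog a b -> Q b.
Hypothesis Q_progress : forall a, Q a -> exists b, mstep prog a b.

Lemma diverging_run a C : Q a -> live a C ->
  exists r : nat -> config machine_pcs,
    r 0 = C /\ forall n, step sem (r n) (r n.+1).
Proof.
move=> ha hC.
(* One machine step takes several channel steps, so the invariant also admits configurations on the
   way to a live one. The run is obtained by choosing successors within it. *)
pose inv C := exists D a,
  [/\ clos_refl_trans_1n _ (@step sem machine_pcs) C D, live a D & Q a].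
have inv_step (s : {C | inv C}) :
    exists s' : {C | inv C}, step sem (sval s) (sval s').
  case: s => C' hC' /=; have [D [a' [CD hD ha']]] := hC'.
  have [b hab] := Q_progress ha'; have [E [F [DE EF hF]]] := live_mstep hD hab.
  have hb := Q_mstep ha' hab; case: CD DE hD => {D} [|D' D CD' D'D] DE hD.
    have hE : inv E by exists F, b.
    by exists (exist _ E hE).
  have hD' : inv D' by exists D, a'.
  by exists (exist _ D' hD').
have hinv : inv C by exists C, a; split=> //; exact: rt1n_refl.
pose nxt s := sval (constructive_indefinite_description _ (inv_step s)).
exists (fun n => sval (iter n nxt (exist _ C hinv))); split=> // n.
exact: svalP (constructive_indefinite_description _ (inv_step _)).
Qed.

(** By soundness [D] simulates some machine configuration in [Q]. State [0] would place it at the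
    halting address [0], against [Q_progress]. *)
Lemma diverging_unreachable a C D :
  nth IHalt prog 0 = IHalt -> Q a -> live a C ->
  clos_refl_trans _ (@step sem machine_pcs) C D -> val D.1 <> 0.
Proof.
move=> h0 ha hC hCD; have {hCD}CD := clos_rt_rtn1 _ _ _ _ hCD.
suff [b hb [_ [m [hm _]]]] : exists2 b, Q b & sim b D.
  case: b hb hm => i rho hb /= -> him; have [b] := Q_progress hb.
  have -> : i = 0 by lia.
  exact: mstep_halt.
elim: CD => {D} [|D E DE _ [b hb hD]]; first by exists a => //; apply: live_sim.
case: (sim_step hD DE) => [[hE _]|[b' hbb' hE]]; first by exists b.
by exists b' => //; apply: Q_mstep hbb'.
Qed.

End Divergence.

End Simulation.

(** * Computing the code of an instance *)

Definition comp1 k (f : murec 1) (g : murec k) : murec k := Comp f (fun _ => g).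

Definition comp2 k (f : murec 2) (g h : murec k) : murec k :=
  Comp f (fun i => if val i == 0 then g else h).

Definition const_zero k : murec k :=
  Comp Zero (fun i : 'I_0 => False_rect _ (notF (ltn_ord i))).

Fixpoint const k (c : nat) : murec k :=
  if c is c'.+1 then comp1 Succ (const k c') else const_zero k.

Lemma computes_comp1 k (f : murec 1) (g : murec k) v y z :
  computes g v y -> computes f [tuple y] z -> computes (comp1 f g) v z.
Proof. by move=> hg hf; exists [tuple y]; split=> // i; rewrite ord1. Qed.

Lemma computes_comp2 k (f : murec 2) (g h : murec k) v y z t :
  computes g v y -> computes h v z -> computes f [tuple y; z] t ->
  computes (comp2 f g h) v t.
Proof.
move=> hg hh hf; exists [tuple y; z]; split=> // i.
by case: i => [[|[|]]].
Qed.

Lemma computes_const k c v : computes (const k c) v c.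
Proof.
elim: c => [|c IH]; last by apply: computes_comp1 IH _.
by exists [tuple]; split=> // -[].
Qed.

Lemma computes_prec k (f : murec k) (g : murec k.+2) (F : nat -> nat) n v :
  computes f v (F 0) ->
  (forall p, computes g (cons_tuple p (cons_tuple (F p) v)) (F p.+1)) ->
  computes (Prec f g) (cons_tuple n v) (F n).
Proof.
move=> hf hg /=; rewrite theadE.
have -> : behead_tuple (cons_tuple n v) = v by apply: val_inj.
by elim: n => [|n IH] //=; exists (F n).
Qed.

Definition double_fun : murec 1 :=
  Prec Zero (comp1 Succ (comp1 Succ (Proj (ord_max : 'I_2)))).

Lemma computes_double n : computes double_fun [tuple n] n.*2.
Proof.
apply: (@computes_prec _ _ _ double n [tuple]) => // p.
apply: (@computes_comp1 _ _ _ _ p.*2.+1) => //.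
exact: (@computes_comp1 _ _ _ _ p.*2).
Qed.

(** The cons step of [CodeSeq.code]; it is computed by doubling [x] times. *)
Definition pairing x y := 2 ^ x * y.*2.+1.

Lemma code_cons x s : CodeSeq.code (x :: s) = pairing x (CodeSeq.code s).
Proof. by []. Qed.

Definition pairing_fun : murec 2 :=
  Prec (comp1 Succ double_fun) (comp1 double_fun (Proj (inord 1 : 'I_3))).

Lemma computes_pairing x y : computes pairing_fun [tuple x; y] (pairing x y).
Proof.
have -> : [tuple x; y] = cons_tuple x [tuple y] by apply: val_inj.
apply: (@computes_prec _ _ _ (pairing^~ y)) => [|p].
  by apply: computes_comp1 (computes_double _) _; rewrite /pairing mul1n.
have -> : pairing p.+1 y = (pairing p y).*2 by rewrite /pairing expnS -mulnA mul2n.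
apply: computes_comp1 (computes_double _).
by rewrite /= (tnth_nth 0) inordK.
Qed.

Definition word_code n := CodeSeq.code [seq val a | a <- counter_word n].

Definition word_fun : murec 1 :=
  Prec (const 0 1) (comp2 pairing_fun (const 2 1) (Proj (ord_max : 'I_2))).

Lemma computes_word n : computes word_fun [tuple n] (word_code n).
Proof.
apply: (@computes_prec _ _ _ word_code n [tuple]) => [|p].
  (* A zero counter is the lone marker, and the code of [[:: 0]] is [1]. *)
  exact: computes_const.
apply: computes_comp2 (computes_const _ _) _ (computes_pairing _ _).
by rewrite /= (tnth_nth 0).
Qed.

(** The code of the initial configuration whose first two channels represent
    [a] and [b], the remaining ones having a list of codes coded by [b]. *)
Definition init_code a b :=
  CodeSeq.code [:: 4; pairing (word_code a) (pairing (word_code b) b)].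

Definition init_fun : murec 2 :=
  comp2 pairing_fun (const 2 4)
    (comp2 pairing_fun
      (comp2 pairing_fun (comp1 word_fun (Proj (ord0 : 'I_2)))
        (comp2 pairing_fun (comp1 word_fun (Proj (ord_max : 'I_2)))
          (Proj (ord_max : 'I_2))))
      (const 2 0)).

Lemma computes_init a b : computes init_fun [tuple a; b] (init_code a b).
Proof.
have ha : computes (Proj (ord0 : 'I_2)) [tuple a; b] a by [].
have hb : computes (Proj (ord_max : 'I_2)) [tuple a; b] b by [].
apply: computes_comp2 (computes_const _ _) _ (computes_pairing _ _).
apply: computes_comp2 _ (computes_const _ _) (computes_pairing _ _).
apply: computes_comp2 (computes_comp1 ha (computes_word _)) _ (computes_pairing _ _).
exact: computes_comp2 (computes_comp1 hb (computes_word _)) hb (computes_pairing _ _).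
Qed.

Definition term_code a b := CodeSeq.code [:: a; init_code a b].

Definition term_fun : murec 2 :=
  comp2 pairing_fun (Proj (ord0 : 'I_2))
    (comp2 pairing_fun init_fun (const 2 0)).

Lemma computes_term a b : computes term_fun [tuple a; b] (term_code a b).
Proof.
apply: (@computes_comp2 _ _ _ _ _ a) (computes_pairing _ _) => //.
exact: computes_comp2 (computes_init _ _) (computes_const _ _) (computes_pairing _ _).
Qed.

Definition reach_code g a b := CodeSeq.code [:: a; init_code a b; g].

Definition reach_fun g : murec 2 :=
  comp2 pairing_fun (Proj (ord0 : 'I_2))
    (comp2 pairing_fun init_fun (comp2 pairing_fun (const 2 g) (const 2 0))).

Lemma computes_reach g a b :
  computes (reach_fun g) [tuple a; b] (reach_code g a b).
Proof.
apply: (@computes_comp2 _ _ _ _ _ a) (computes_pairing _ _) => //.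
apply: computes_comp2 (computes_init _ _) _ (computes_pairing _ _).
exact: computes_comp2 (computes_const _ _) (computes_const _ _) (computes_pairing _ _).
Qed.

Definition odd_fun : murec 1 :=
  Prec (const 0 0)
    (comp1 (Prec (const 0 1) (const 2 0)) (Proj (ord_max : 'I_2))).

Lemma computes_odd n : computes odd_fun [tuple n] (odd n).
Proof.
apply: (@computes_prec _ _ _ odd n [tuple]) => [|p].
  exact: computes_const.
apply: (@computes_comp1 _ _ _ _ (odd p)); first by rewrite /= (tnth_nth 0).
have -> : nat_of_bool (odd p.+1) = (fun n => nat_of_bool (n == 0)) (odd p).
  by rewrite /=; case: (odd p).
apply: (@computes_prec _ _ _ (fun n => nat_of_bool (n == 0)) (odd p) [tuple]) => [|q].
  exact: computes_const.
exact: computes_const.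
Qed.

(** A power of two times an odd number is odd only for exponent [0]. Hence parity of the code of a
    configuration decides whether its state is [0]. *)
Lemma odd_code_cons x s : odd (CodeSeq.code (x :: s)) = (x == 0).
Proof. by rewrite code_cons /pairing oddM oddX /= odd_double; case: x. Qed.

(** * Diagonalization *)

Definition init_regs (a b : nat) : regs := upd (upd (fun=> 0) 1 b) 0 a.

(** Halts if the value of [f] is [0], and diverges if it is positive. *)
Definition diag_prog (f : murec 2) : seq instr :=
  IHalt :: assemble (Seq (compile f [:: 0; 1] 2 3) (Loop 2 (Inc 2))) 1 0.

Lemma exec_compile2 (f : murec 2) a b y : computes f [tuple a; b] y ->
  exec (compile f [:: 0; 1] 2 3) (init_regs a b) (upd (init_regs a b) 2 y).
Proof.
move=> hf; apply: (compileP hf) => //.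
- by move=> r; rewrite !inE => /orP[] /eqP->.
- by case=> [|[|[|]]].
Qed.

Lemma diag_prog_halts f a b : computes f [tuple a; b] 0 -> exists rho,
  clos_refl_trans_1n _ (mstep (diag_prog f)) (1, init_regs a b) (0, rho).
Proof.
move=> /exec_compile2 hf; exists (upd (init_regs a b) 2 0).
apply: clos_rt_rt1n; apply: assembleP; last first.
  by move=> k _; rewrite add1n.
exact: ExecSeq hf (ExecLoop0 _ _).
Qed.

Lemma diag_prog_diverges f a b : computes f [tuple a; b] 1 ->
  exists Q : nat * regs -> Prop, [/\ Q (1, init_regs a b),
    forall c d, Q c -> mstep (diag_prog f) c d -> Q d &
    forall c, Q c -> exists d, mstep (diag_prog f) c d].
Proof.
move=> /exec_compile2 hf; set prog := diag_prog f.
set L := 1 + cmd_size (compile f [:: 0; 1] 2 3).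
have [] : code_at prog 1 (assemble (compile f [:: 0; 1] 2 3) 1 L) /\
    code_at prog L [:: IJzdec 2 0 L.+1; IInc 2 L].
  have : code_at prog 1
      (assemble (Seq (compile f [:: 0; 1] 2 3) (Loop 2 (Inc 2))) 1 0).
    by move=> k _; rewrite add1n.
  by move/code_at_cat; rewrite size_assemble.
move=> hc /code_at_cons[hL /code_at_cons[hL' _]].
have run := clos_rt_rt1n _ _ _ _ (assembleP hf hc).
set rho := upd (init_regs a b) 2 1 in run.
have hrho : rho 2 = 1 := upd_at _ _ _.
have hupd : upd (upd rho 2 0) 2 1 = rho by rewrite upd_upd upd_same.
clearbody prog L rho.
have step1 : mstep prog (L, rho) (L.+1, upd rho 2 0) by rewrite /mstep /mnext /= hL hrho.
have step2 : mstep prog (L.+1, upd rho 2 0) (L, rho).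
  by rewrite /mstep /mnext /= hL' upd_at hupd.
(* [Q] consists of the configurations leading to the two-step cycle through [L]; determinism makes
   it closed under steps. *)
exists (fun c => clos_refl_trans_1n _ (mstep prog) c (L, rho)); split=> //.
  move=> c d; move Ee : (L, rho) => e hce.
  case: hce Ee => {e} [<-|c' e hcc' hc'e Ee hcd].
    move/(mstep_det step1) => <-.
    exact: Relation_Operators.rt1n_trans step2 (rt1n_refl _ _ _).
  by rewrite -(mstep_det hcc' hcd).
move=> c; move Ee : (L, rho) => e hce.
case: hce Ee => {e} [<-|c' e hcc' _ _]; last by exists c'.
by exists (L.+1, upd rho 2 0).
Qed.

(** State [4] is stage [0] of address [1], the entry point of [diag_prog]. *)
Definition init_config prog a b : config (machine_pcs prog) :=
  (inord 4, [ffun c => counter_word (init_regs a b (val c))]).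

Lemma live_init prog a b : prog <> [::] ->
  live (1, init_regs a b) (init_config prog a b).
Proof.
move=> hprog; split=> [|c] /=; last by rewrite ffunE ones_counter_word zeros_counter_word.
rewrite inordK // !ltnS muln_gt0 /= /prog_bound.
by case: prog hprog.
Qed.

Lemma val_enum_rank n (i : 'I_n) : val (enum_rank i) = val i.
Proof. by rewrite enum_rank_ord. Qed.

(** Every channel from the third on holds the lone marker, with code [1], so [b] codes the list of
    their contents. It depends on [prog] only and can therefore itself be an input. *)
Lemma enc_init prog a : prog <> [::] ->
  let b := CodeSeq.code (nseq (prog_bound prog) 1) in
  enc_config (init_config prog a b) = init_code a b.
Proof.
move=> hprog b; rewrite /enc_config /init_code.
have -> : val (enum_rank (init_config prog a b).1) = 4.
  rewrite [LHS](@val_enum_rank (4 * prog_bound prog).+4).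
  by case: (live_init a b hprog).
congr (CodeSeq.code [:: _; _]).
have -> : [seq CodeSeq.code [seq val l | l <- (init_config prog a b).2 c] |
             c <- enum (chan (machine_pcs prog))] =
  [seq word_code (init_regs a b i) | i <- map val (enum 'I_(prog_bound prog).+2)].
  rewrite -map_comp; apply: eq_map => c /=.
  by rewrite ffunE.
rewrite val_enum_ord !code_cons /=; congr (pairing _ (pairing _ _)).
rewrite /b; congr CodeSeq.code; apply: (@eq_from_nth _ 0) => [|i].
  by rewrite size_map size_iota size_nseq.
rewrite size_map size_iota => hi.
by rewrite (nth_map 0) ?size_iota // nth_iota // nth_nseq hi.
Qed.

Lemma Acc_no_run (T : Type) (R : T -> T -> Prop) x : Acc (fun y x => R x y) x ->
  forall r : nat -> T, r 0 = x -> ~ (forall n, R (r n) (r n.+1)).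
Proof.
elim=> {}x _ IH r r0 hr; apply: (IH (r 1) _ (fun n => r n.+1)) => //.
by rewrite -r0.
Qed.

(** * Undecidability for every semantics covered by [lossy] *)

Section Undecidability.

Variable sem : semantics.
Hypothesis sem_lossy : forall x y : seq 'I_2, @sem 1 x y -> lossy x y.

Lemma termination_undecidable :
  ~ recursively_decidable enc_term (termination sem).
Proof.
case=> f hf; pose prog := diag_prog (comp1 f term_fun).
(* Self-reference needs no recursion theorem: the program is fixed first and receives the code of
   its own system in register [0]. *)
pose a := enc_pcs (machine_pcs prog).
pose b := CodeSeq.code (nseq (prog_bound prog) 1).
pose i := TermInstance (init_config prog a b).
have hlive : live (1, init_regs a b) (init_config prog a b) by apply: live_init.
have run y : computes f [tuple enc_term i] y ->
    computes (comp1 f term_fun) [tuple a; b] y.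
  apply: computes_comp1; have := computes_term a b.
  by rewrite /term_code -enc_init.
(* Refuting one answer first leaves only the other, so no case distinction on termination is
   made. *)
have not_term : ~ termination sem i.
  move=> hi; have [/(_ hi)/run/diag_prog_diverges[Q [hQ Qstep Qprog]] _] := hf i.
  by have [r [r0 hr]] := diverging_run sem Qstep Qprog hQ hlive; apply: hi r0 hr.
have [_ /(_ not_term)/run/diag_prog_halts[rho hhalt]] := hf i.
have h0 : nth IHalt prog 0 = IHalt by [].
have hacc := sim_Acc sem_lossy (halting_Acc h0 hhalt) (live_sim hlive).
by apply: not_term => r r0; apply: Acc_no_run hacc r r0.
Qed.

Definition halted prog (D : config (machine_pcs prog)) : Prop := val D.1 = 0.

Lemma halted_decidable prog :
  decides (@enc_config (machine_pcs prog)) (@halted prog) odd_fun.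
Proof.
move=> D; have := computes_odd (enc_config D).
have -> : odd (enc_config D) = (val D.1 == 0).
  rewrite /enc_config odd_code_cons.
  by rewrite [val (enum_rank _)](@val_enum_rank (4 * prog_bound prog).+4).
by rewrite /halted; case: (val D.1 =P 0).
Qed.

Lemma reachability_undecidable :
  ~ recursively_decidable enc_reach (reachability sem).
Proof.
(* The goal is decided by [odd_fun] whatever the program is, so its Gödel number can be built into
   [g] before [prog] is defined. *)
case=> f hf; pose g := comp1 f (reach_fun (enc_murec odd_fun)).
pose prog := diag_prog g.
pose a := enc_pcs (machine_pcs prog).
pose b := CodeSeq.code (nseq (prog_bound prog) 1).
pose i := ReachInstance (init_config prog a b) (@halted_decidable prog).
have hlive : live (1, init_regs a b) (init_config prog a b) by apply: live_init.
have run y : computes f [tuple enc_reach i] y -> computes g [tuple a; b] y.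
  apply: computes_comp1; have := computes_reach (enc_murec odd_fun) a b.
  by rewrite /reach_code -enc_init.
have h0 : nth IHalt prog 0 = IHalt by [].
have unreach : ~ reachability sem i.
  move=> hi; have [/(_ hi)/run/diag_prog_diverges[Q [hQ Qstep Qprog]] _] := hf i.
  have [D [hD CD]] := hi.
  exact: (diverging_unreachable sem_lossy Qstep Qprog h0 hQ hlive CD hD).
have [_ /(_ unreach)/run/diag_prog_halts[rho hhalt]] := hf i.
by have [D hD CD] := halting_reach sem hhalt hlive; apply: unreach; exists D.
Qed.

End Undecidability.

Theorem theorem6p1 :
  (~ recursively_decidable enc_reach (reachability strict_superseding) /\
   ~ recursively_decidable enc_term (termination strict_superseding)) /\
  (~ recursively_decidable enc_reach (reachability overtaking) /\
   ~ recursively_decidable enc_term (termination overtaking)).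
Proof.
split; split.
- exact: reachability_undecidable strict_superseding_lossy.
- exact: termination_undecidable strict_superseding_lossy.
- exact: reachability_undecidable overtaking_lossy.
- exact: termination_undecidable overtaking_lossy.
Qed.
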